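(* Let $\{\lambda_j\}$ be a (finite or infinite) sequence in the open unit disc $\mathbb{D}$ such that $\mu_0=\sum_j(1-|\lambda_j|^2)\delta_{\lambda_j}$ is a Carleson measure, and let $0<r<1$. Then there is a constant $C>0$, depending only on $r$ and $\{\lambda_j\}$, such that for every $\eta$ with $0<\eta<r$ and every sequence $\{\lambda'_j\}$ with $\lambda'_j\in\Delta(\lambda_j,\eta)$ for all $j$, $$\mathcal{B}\big(\{k_{\lambda_j}-k_{\lambda'_j}\}\big)\le C\,\eta .$$ Equivalently, $\sum_j|\langle f,k_{\lambda_j}-k_{\lambda'_j}\rangle|^2\le C^2\eta^2\|f\|^2$ for all $f\in H^2$.
   Context: $H^2$ is the Hardy space of $\mathbb{D}$, and for $\lambda\in\mathbb{D}$, $k_\lambda(z)=(1-|\lambda|^2)^{1/2}/(1-\overline{\lambda}z)$ is the normalized reproducing kernel. The pseudo-hyperbolic metric is $\rho(z,w)=\left|\frac{z-w}{1-\overline{z}w}\right|$, and $\Delta(z,r)=\{w\in\mathbb{D}:\rho(z,w)<r\}$. $\delta_\lambda$ is the unit point mass at $\lambda$. A positive measure $\mu$ on $\mathbb{D}$ is Carleson if there is a constant $C$ with $\int|f|^2d\mu\le C\|f\|^2$ for all $f\in H^2$. A sequence $\{f_j\}$ in $H^2$ is Bessel if there is $B\ge 0$ with $\sum_j|\langle f,f_j\rangle|^2\le B^2\|f\|^2$ for all $f\in H^2$; $\mathcal{B}^2(\{f_j\})$ denotes the smallest such constant $B^2$, and $\mathcal{B}(\{f_j\})\ge 0$ is its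 square root. *)

(* Defs.v *)
(* MathComp-Analysis, over an abstract realType R; complex numbers are R[i]. *)
From HB Require Import structures.
From mathcomp Require Import all_boot all_order all_algebra.
From mathcomp Require Import complex.
From mathcomp Require Import all_classical all_reals all_analysis.
Import Order.TTheory GRing.Theory Num.Theory.
Import numFieldNormedType.Exports.

Set Implicit Arguments.
Unset Strict Implicit.
Unset Printing Implicit Defensive.

Local Open Scope classical_set_scope.
Local Open Scope complex_scope.
Local Open Scope ring_scope.

Section HardySpace.
Variable R : realType.

(* The norm `|z| of R[i] takes its values in R[i]; this is the same modulus
   as an element of R. *)
Definition cmod (z : R[i]) : R := complex.Re `|z|.

Definition disc : set R[i] := [set z | cmod z < 1].

(* The topology of the complex numbers is carried by R[i]^o. *)
Definition has_power_series (f : R[i] -> R[i]) (a : nat -> R[i]) : Prop :=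
  forall z, disc z ->
    series (fun n => a n * z ^+ n : R[i]^o) @ \oo --> (f z : R[i]^o).

Definition square_summable (a : nat -> R[i]) : Prop :=
  cvgn (series (fun n => cmod (a n) ^+ 2)).

(* H^2 consists of the functions f(z) = sum_n a_n z^n on the disc with
   sum_n |a_n|^2 finite. An element is represented by any function on R[i]
   extending it; only the values on the disc matter below. *)
Definition hardy (f : R[i] -> R[i]) : Prop :=
  exists a, has_power_series f a /\ square_summable a.

(* Unique when f has a power series on the disc; the default value 0 is used
   otherwise. *)
Definition taylor (f : R[i] -> R[i]) : nat -> R[i] :=
  xget (fun=> 0) [set a | has_power_series f a].

Definition inner (f g : R[i] -> R[i]) : R[i] :=
  limn (series (fun n => taylor f n * (taylor g n)^* : R[i]^o)).

Definition hnorm (f : R[i] -> R[i]) : R := Num.sqrt (complex.Re (inner f f)).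

Definition kernel_fun (l : R[i]) : R[i] -> R[i] :=
  fun z => (Num.sqrt (1 - cmod l ^+ 2))%:C / (1 - l^* * z).

Definition rho (z w : R[i]) : R := cmod ((z - w) / (1 - z^* * w)).

Definition Delta (z : R[i]) (r : R) : set R[i] :=
  [set w | disc w /\ rho z w < r].

Definition borelC := g_sigma_algebraType (@open R[i]^o).

(* Positive measures on the disc are represented by Borel measures on R[i],
   of which only the restriction to the disc is used. *)
Definition carleson (mu : {measure set borelC -> \bar R}) : Prop :=
  exists C : R, forall f, hardy f ->
    (\int[mu]_(z in (disc : set borelC)) (cmod (f z) ^+ 2)%:E
       <= (C * hnorm f ^+ 2)%:E)%E.

(* (1 - |l|^2) times the unit mass at l; the outer absolute value only
   serves to make the weight nonnegative by typing, and is void on the disc. *)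
Definition atom (l : R[i]) : {measure set borelC -> \bar R} :=
  mscale (`|1 - cmod l ^+ 2|)%:nng (@dirac _ borelC l R).

(* Sequences are indexed by {0, ..., n-1} when N = Some n, and by all of nat
   when N = None; they are represented by functions on nat, whose values
   outside the index set are irrelevant. *)
Definition index_set (N : option nat) : set nat :=
  if N is Some n then `I_n else setT.

Definition mu0 (N : option nat) (lam : nat -> R[i]) :
    {measure set borelC -> \bar R} :=
  match N with
  | Some n => msum (fun j => atom (lam j)) n
  | None => mseries (fun j => atom (lam j)) 0
  end.

Definition bessel_bound (N : option nat) (g : nat -> R[i] -> R[i]) (B : R)
    : Prop :=
  0 <= B /\ forall f, hardy f ->
    (\esum_(j in index_set N) (cmod (inner f (g j)) ^+ 2)%:E
       <= (B ^+ 2 * hnorm f ^+ 2)%:E)%E.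

Definition bessel (N : option nat) (g : nat -> R[i] -> R[i]) : Prop :=
  (forall j, index_set N j -> hardy (g j)) /\ exists B, bessel_bound N g B.

(* The smallest constant B^2. Meaningful for Bessel sequences only: inf of
   the empty set is 0. *)
Definition bessel_const2 (N : option nat) (g : nat -> R[i] -> R[i]) : R :=
  inf [set B ^+ 2 | B in [set B | bessel_bound N g B]].

Definition bessel_const (N : option nat) (g : nat -> R[i] -> R[i]) : R :=
  Num.sqrt (bessel_const2 N g).

End HardySpace.

(* Main.v *)
Require Import Defs.
From HB Require Import structures.
From mathcomp Require Import all_boot all_order all_algebra.
From mathcomp Require Import complex.
From mathcomp Require Import all_classical all_reals all_analysis.
From mathcomp Require Import measurable_realfun ring lra.
Import Order.TTheory GRing.Theory Num.Theory.
Import numFieldNormedType.Exports.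
Local Open Scope classical_set_scope.
Local Open Scope complex_scope.
Local Open Scope ring_scope.

Set Implicit Arguments.
Unset Strict Implicit.
Unset Printing Implicit Defensive.

(** The reproducing property turns [<f, k_l - k_l'>] into [s f(l) - s' f(l')],
    where [s ^ 2 = d = 1 - |l|^2] and [s' ^ 2 = 1 - |l'|^2], and we split it as
    [(s - s') f(l) + s' (f(l) - f(l'))].

    Pseudo-hyperbolic proximity gives [|l - l'| <= k eta d] with
    [k = 1 / (1 - r)] (lemma [rho_dist]), hence [|s - s'| <= 2 k eta s]
    ([normalization_dist]), and the first part is controlled by the Carleson
    hypothesis applied to [f] itself.

    For the second part put [K_l(z) = 1 / (1 - conj l z)], so that
    [f(l) - f(l') = <f, K_l - K_l'>]. The Gram matrix of the differences
    [K_l - K_l'] can be computed exactly ([gram_csum]), and differencing in both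
    variables improves the homogeneity of its entries from
    [1 / (1 - conj a b)] to
    [O(eta^2 (1 - |a|^2) (1 - |b|^2) / |1 - conj a b|^3)] ([gram_bound]).
    Schur's test can fail at the first homogeneity but succeeds at the second; the
    row sums it requires are bounded by those of
    [(1 - |a|^2) (1 - |b|^2) / |1 - conj a b|^2], and these are what the
    Carleson inequality says for the normalized kernel [f = k_a]
    ([kernel_row_sum], [schur_cubic]). A bound on the Gram matrix is a bound on
    the Bessel constant ([bessel_of_gram]).

    The estimates are made for the first [n] points, with constants
    independent of [n], and inner products are limits of partial sums over
    Taylor coefficients. These coefficients are determined by the function
    ([has_power_series_inj]), so the explicit ones of the kernels may be
    used. *)

(** * The modulus of a complex number as a real number *)

Section Modulus.
Variable R : realType.
Implicit Types z w : R[i].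

Lemma normc_cmod z : `|z| = (cmod z)%:C.
Proof. by rewrite /cmod normc_def. Qed.

Lemma cmod_ge0 z : 0 <= cmod z.
Proof. by rewrite -ler0c -normc_cmod. Qed.
#[local] Hint Resolve cmod_ge0 : core.

Lemma cmodM z w : cmod (z * w) = cmod z * cmod w.
Proof. by apply: complexI; rewrite rmorphM /= -!normc_cmod normrM. Qed.

Lemma cmodV z : cmod z^-1 = (cmod z)^-1.
Proof. by apply: complexI; rewrite fmorphV /= -!normc_cmod normfV. Qed.

Lemma cmodX z n : cmod (z ^+ n) = cmod z ^+ n.
Proof. by apply: complexI; rewrite rmorphXn /= -!normc_cmod normrX. Qed.

Lemma cmodN z : cmod (- z) = cmod z.
Proof. by apply: complexI; rewrite -!normc_cmod normrN. Qed.

Lemma cmodC z w : cmod (z - w) = cmod (w - z).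
Proof. by rewrite -cmodN opprB. Qed.

Lemma cmodJ z : cmod z^* = cmod z.
Proof. by apply: complexI; rewrite -!normc_cmod norm_conjC. Qed.

Lemma cmod_real (x : R) : cmod x%:C = `|x|.
Proof. by rewrite /cmod normc_def /= expr0n /= addr0 sqrtr_sqr. Qed.

Lemma cmod0 : cmod (0 : R[i]) = 0.
Proof. by apply: complexI; rewrite -normc_cmod normr0. Qed.

Lemma cmod1 : cmod (1 : R[i]) = 1.
Proof. by apply: complexI; rewrite -normc_cmod normr1. Qed.

Lemma cmod_eq0 z : (cmod z == 0) = (z == 0).
Proof. by rewrite -[RHS]normr_eq0 normc_cmod -(inj_eq (@complexI R)). Qed.

Lemma cmod_triangle z w : cmod (z + w) <= cmod z + cmod w.
Proof. by rewrite -lecR rmorphD /= -!normc_cmod ler_normD. Qed.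

Lemma cmod_triangleB z w : cmod (z - w) <= cmod z + cmod w.
Proof. by rewrite -(cmodN w) cmod_triangle. Qed.

Lemma cmod_sum (I : Type) (r : seq I) (P : pred I) (F : I -> R[i]) :
  cmod (\sum_(i <- r | P i) F i) <= \sum_(i <- r | P i) cmod (F i).
Proof.
elim/big_ind2 : _ => [|x a y b Ha Hb|//]; first by rewrite cmod0.
exact: le_trans (cmod_triangle _ _) (lerD Ha Hb).
Qed.

Lemma mulcJ_cmod z : z * z^* = (cmod z ^+ 2)%:C.
Proof. by rewrite -normCK normc_cmod rmorphXn. Qed.

Lemma Re_le_cmod z : `|complex.Re z| <= cmod z.
Proof.
rewrite /cmod normc_def /= -sqrtr_sqr ler_wsqrtr // lerDl; exact: sqr_ge0.
Qed.

Lemma conj_realc (x : R) : (x%:C)^* = x%:C.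
Proof.
by apply: conj_Creal; apply/complex_realP; exists x.
Qed.

Lemma cmodB_sqr_le z w : cmod (z - w) ^+ 2 <= 2 * cmod z ^+ 2 + 2 * cmod w ^+ 2.
Proof.
apply: (@le_trans _ _ ((cmod z + cmod w) ^+ 2)).
  by rewrite lerXn2r ?nnegrE ?addr_ge0 ?cmod_triangleB.
have := sqr_ge0 (cmod z - cmod w); nra.
Qed.

End Modulus.

(** * Sums of complex series *)

Section ComplexSeries.
Variable R : realType.
Implicit Types (u v : nat -> R[i]) (k l z : R[i]).

(** The neighbourhoods of [R[i]^o] are given by radii in [R[i]], and a positive
    element of [R[i]] is real; this is why limits in [R[i]^o] can be tested on
    real moduli. *)
Lemma cvg_cmodP u l :
  ((u : nat -> R[i]^o) @ \oo --> (l : R[i]^o)) <->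
  ((fun n => cmod (u n - l)) @ \oo --> (0 : R)).
Proof.
split=> [/cvgrPdist_lt H|/cvgrPdist_lt H].
- apply/cvgrPdist_lt => e e0.
  have := H e%:C; rewrite ltcR => /(_ e0); apply: filterS => n /=.
  by rewrite normc_cmod ltcR sub0r normrN ger0_norm ?cmod_ge0 // cmodC.
- apply/cvgrPdist_lt => e e0.
  have eE : e = (complex.Re e)%:C.
    by rewrite RRe_real // realE (ltW e0).
  have := H (complex.Re e); rewrite -ltcR -eE => /(_ e0).
  apply: filterS => n /=.
  by rewrite normc_cmod eE ltcR sub0r normrN ger0_norm ?cmod_ge0 // cmodC.
Qed.

Definition csum u l := series (u : nat -> R[i]^o) @ \oo --> (l : R[i]^o).

Lemma csum_lim u l : csum u l -> limn (series (u : nat -> R[i]^o)) = l.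
Proof. by by move=> H; apply: (cvg_lim (@norm_hausdorff _ R[i]^o) H). Qed.

Lemma eq_csum u v l : u =1 v -> csum u l -> csum v l.
Proof. by move=> /funext ->. Qed.

Lemma csumD u v k l : csum u k -> csum v l -> csum (fun n => u n + v n) (k + l).
Proof.
move=> Hu Hv; rewrite /csum.
rewrite (_ : series _ = series (u : nat -> R[i]^o) + series (v : nat -> R[i]^o)).
  exact: (cvgD Hu Hv).
by apply/funext => n /=; rewrite /series /= big_split.
Qed.

Lemma csumZ u l k : csum u l -> csum (fun n => k * u n) (k * l).
Proof.
move=> Hu; rewrite /csum.
rewrite (_ : series _ = (cst (k : R[i]^o)) \* series (u : nat -> R[i]^o)).
  exact: (cvgM (cvg_cst (k : R[i]^o)) Hu).
by apply/funext => n /=; rewrite /series /= mulr_sumr.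
Qed.

Lemma csumN u l : csum u l -> csum (fun n => - u n) (- l).
Proof.
move=> /(csumZ (k := -1)); rewrite mulN1r.
by apply: eq_csum => n; rewrite mulN1r.
Qed.

Lemma csumB u v k l : csum u k -> csum v l -> csum (fun n => u n - v n) (k - l).
Proof. by move=> Hu Hv; exact: csumD Hu (csumN Hv). Qed.

Lemma csum_sum (m : nat) (u : nat -> nat -> R[i]) (l : nat -> R[i]) :
  (forall j, (j < m)%N -> csum (u j) (l j)) ->
  csum (fun n => \sum_(j < m) u j n) (\sum_(j < m) l j).
Proof.
elim: m => [|m IH] H.
  rewrite big_ord0; apply: (@eq_csum (fun=> 0)) => [n|]; first by rewrite big_ord0.
  rewrite /csum (_ : series _ = cst (0 : R[i]^o)); first exact: cvg_cst.
  by apply/funext => n; rewrite /series /= big1.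
rewrite big_ord_recr /=.
apply: (@eq_csum (fun n => \sum_(j < m) u j n + u m n)) => [n|].
  by rewrite big_ord_recr.
by apply: csumD; [apply: IH => j jm; apply: H; exact: ltnW|exact: H].
Qed.

Lemma csumJ u l : csum u l -> csum (fun n => (u n)^*) l^*.
Proof.
rewrite /csum => /cvg_cmodP H; apply/cvg_cmodP.
apply: cvg_trans H; apply: near_eq_cvg; near=> n.
by rewrite /series /= -rmorph_sum /= -rmorphB /= cmodJ.
Unshelve. all: by end_near. Qed.

Lemma csum_real (a : nat -> R) (s : R) :
  series a @ \oo --> s -> csum (fun n => (a n)%:C) s%:C.
Proof.
move=> /cvgrPdist_lt H; apply/cvg_cmodP/cvgrPdist_lt => e /H.
apply: filterS => n /=.
rewrite /series /= -rmorph_sum /= -rmorphB /= cmod_real.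
by rewrite sub0r normrN normr_id distrC.
Qed.

Lemma csum_Re_ge0 u l : (forall n, 0 <= complex.Re (u n)) -> csum u l ->
  0 <= complex.Re l.
Proof.
move=> u0 /cvg_cmodP /cvgrPdist_lt H; rewrite leNgt; apply/negP => l0.
have e0 : 0 < - complex.Re l by rewrite oppr_gt0.
have [n _ /(_ n (leqnn n))] := H _ e0.
rewrite /= sub0r normrN ger0_norm ?cmod_ge0 // => /(le_lt_trans (Re_le_cmod _)).
have : 0 <= complex.Re (series (u : nat -> R[i]^o) n).
  rewrite /series /=; elim/big_ind : _ => [|[? ?] [? ?] /=|i _] //.
  exact: addr_ge0.
case: (series _ n) l {H u0} l0 e0 => [a b] [c d] /= c0 e0 a0.
by rewrite ltr_norml => /andP[_]; lra.
Qed.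

Lemma csum_geometric z : disc z -> csum (fun n => z ^+ n) (1 - z)^-1.
Proof.
rewrite /disc /= => z1.
have z1' : 1 - z != 0.
  by rewrite subr_eq0; apply: contraTneq z1 => <-; rewrite cmod1 ltxx.
apply/cvg_cmodP.
have H : (fun n => (cmod (1 - z))^-1 * cmod z ^+ n) @ \oo --> (0 : R).
  rewrite -(mulr0 (cmod (1 - z))^-1); apply: cvgM; first exact: cvg_cst.
  by apply: cvg_expr; rewrite ger0_norm ?cmod_ge0.
apply: cvg_trans H; apply: near_eq_cvg; near=> n.
rewrite -cmodX -cmodV -cmodM.
have -> : series (fun n => z ^+ n : R[i]^o) n = (1 - z)^-1 * (1 - z ^+ n).
  apply: (mulfI z1'); rewrite mulrA divff // mul1r.
  by rewrite /series /= big_mkord -opprB mulNr -subrX1 opprB.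
by rewrite mulrBr mulr1 addrAC subrr add0r cmodN.
Unshelve. all: by end_near. Qed.

End ComplexSeries.

Arguments csumZ {R u l} k _.

(** * Taylor coefficients and norms of Hardy functions *)

Section HardyFunctions.
Variable R : realType.
Implicit Types (f g : R[i] -> R[i]) (a b : nat -> R[i]) (l z : R[i]).

Lemma csum_terms_bounded a l : csum a l ->
  exists2 M : R, 0 <= M & forall n, cmod (a n) <= M.
Proof.
move=> /cvg_cmodP H.
have [M [Mr HM]] := cvg_seq_bounded (cvgP _ H).
have {}HM n : cmod (series (a : nat -> R[i]^o) n - l) <= `|M| + 1.
  have := HM (`|M| + 1); rewrite ltr_pwDr ?ler_norm // => /(_ isT n I) /=.
  by rewrite ger0_norm ?cmod_ge0.
exists (2 * (`|M| + 1)) => [|n]; first by rewrite mulr_ge0 // addr_ge0.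
have -> : a n = (series (a : nat -> R[i]^o) n.+1 - l)
              - (series (a : nat -> R[i]^o) n - l).
  by rewrite opprB addrA subrK /series /= big_nat_recr //= addrAC subrr add0r.
by apply: le_trans (cmod_triangleB _ _) _; rewrite mulr_natl mulr2n lerD.
Qed.

Lemma geometric_sum_le2 (q : R) n : 0 <= q -> q <= 2^-1 ->
  \sum_(i < n) q ^+ i <= 2.
Proof.
move=> q0 q1; have := subrX1 q n.
have := exprn_ge0 n q0.
set S := \sum_(_ < _) _; set p := q ^+ n.
have : 0 <= S by apply: sumr_ge0 => i _; exact: exprn_ge0.
nra.
Qed.

(** Cauchy's estimate at [1/2] makes the terms after the first nonzero one
    a geometric tail of ratio [2 t], so that [a m * t ^+ m = O(t ^+ m.+1)]. *)
Lemma first_coef_bound a (m : nat) (M t : R) :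
  (forall i, (i < m)%N -> a i = 0) ->
  (forall n, cmod (a n * (2^-1)%:C ^+ n) <= M) ->
  0 < t -> t <= 4^-1 -> csum (fun n => a n * t%:C ^+ n) 0 ->
  cmod (a m) <= 4 * M * 2 ^+ m * t.
Proof.
move=> a0 aM t0 t4 /cvg_cmodP/cvgrPdist_lt H.
have {}aM n : cmod (a n) <= M * 2 ^+ n.
  have := aM n; rewrite cmodM cmodX cmod_real ger0_norm ?invr_ge0 //.
  by rewrite exprVn ler_pdivrMr ?exprn_gt0.
rewrite -(ler_pM2r (exprn_gt0 m t0)).
apply/ler_addgt0Pr => e e0; have [n _ Hn] := H e e0.
(* The partial sum must be late enough to be within e of 0 and long enough to
   contain the term of index m. *)
have /Hn : (n <= m.+1 + n)%N by rewrite leq_addl.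
rewrite /= sub0r normrN ger0_norm ?cmod_ge0 // subr0 => {}Hn.
have E : series (fun n => a n * t%:C ^+ n : R[i]^o) (m.+1 + n)%N =
   a m * t%:C ^+ m + \sum_(i < n) a (m.+1 + i)%N * t%:C ^+ (m.+1 + i).
  rewrite /series /= big_mkord big_split_ord /= big_ord_recr /= big1 ?add0r //.
  by move=> i _; rewrite a0 // mul0r.
have -> : cmod (a m) * t ^+ m = cmod (a m * t%:C ^+ m).
  by rewrite cmodM cmodX cmod_real ger0_norm // ltW.
have -> : a m * t%:C ^+ m = series (fun n => a n * t%:C ^+ n : R[i]^o) (m.+1 + n)%N
   - \sum_(i < n) a (m.+1 + i)%N * t%:C ^+ (m.+1 + i) by rewrite E addrK.
apply: le_trans (cmod_triangleB _ _) _; rewrite addrC lerD ?(ltW Hn) //.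
apply: le_trans (cmod_sum _ _ _) _.
apply: (@le_trans _ _ (M * (2 * t) ^+ m.+1 * \sum_(i < n) (2 * t) ^+ i)).
  rewrite mulr_sumr; apply: ler_sum => i _.
  rewrite cmodM cmodX cmod_real ger0_norm ?(ltW t0) //.
  rewrite -mulrA -exprD exprMn mulrA ler_wpM2r ?exprn_ge0 ?(ltW t0) //.
have M0 : 0 <= M by apply: le_trans (cmod_ge0 _) (le_trans (aM 0%N) _); rewrite expr0 mulr1.
apply: (@le_trans _ _ (M * (2 * t) ^+ m.+1 * 2)).
  by rewrite ler_wpM2l ?mulr_ge0 ?exprn_ge0 ?geometric_sum_le2 //; lra.
rewrite exprMn !exprS; set x := 2 ^+ m; set y := t ^+ m.
by rewrite le_eqVlt; apply/orP; left; apply/eqP; ring.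
Qed.

Lemma power_series_eq0 a :
  (forall z, disc z -> csum (fun n => a n * z ^+ n) 0) -> forall n, a n = 0.
Proof.
move=> H n; elim/ltn_ind : n => m IH.
have d t : 0 < t -> t <= 2^-1 -> disc (t%:C : R[i]).
  by move=> t0 t2; rewrite /disc /= cmod_real ger0_norm; lra.
have [|M M0 HM] := csum_terms_bounded (H (2^-1)%:C _).
  by apply: d => //; rewrite invr_gt0.
have B t : 0 < t -> t <= 4^-1 -> cmod (a m) <= 4 * M * 2 ^+ m * t.
  by move=> t0 t4; apply: first_coef_bound (H _ (d _ _ _)) => //; lra.
apply/eqP; rewrite -cmod_eq0 eq_le cmod_ge0 andbT leNgt; apply/negP => c0.
move: B; set K := 4 * M * 2 ^+ m; set c := cmod (a m) in c0 * => B.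
have K0 : 0 <= K by rewrite !mulr_ge0 ?exprn_ge0.
have K1 : 0 < 2 * K + 1 by lra.
(* Any t <= 1/4 with K * t < c contradicts B. *)
pose t := Num.min 4^-1 (c / (2 * K + 1)).
have t0 : 0 < t by rewrite lt_min divr_gt0 // andbT invr_gt0.
have t1 : t * (2 * K + 1) <= c by rewrite -ler_pdivlMr // ge_min lexx orbT.
have t2 : t <= 4^-1 by rewrite ge_min lexx.
have := B _ t0 t2; nra.
Qed.

Lemma has_power_series_inj f a b :
  has_power_series f a -> has_power_series f b -> a = b.
Proof.
move=> fa fb; apply/funext => n; apply/eqP; rewrite -subr_eq0; apply/eqP; move: n.
apply: power_series_eq0 => z dz; rewrite -(subrr (f z)).
by apply: eq_csum (csumB (fa z dz) (fb z dz)) => n; rewrite mulrBl.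
Qed.

Lemma taylorE f a : has_power_series f a -> taylor f = a.
Proof.
move=> fa; rewrite /taylor; apply: (@has_power_series_inj f _ a) => //.
by apply: (@xgetPex _ (fun=> 0) [set a | has_power_series f a]); exists a.
Qed.

(** The form in which inner products are computed below: the coefficients of
    [g] are known explicitly, while those of [f] are only [taylor f]. *)
Lemma innerE f g b l : has_power_series g b ->
  csum (fun n => taylor f n * (b n)^*) l -> inner f g = l.
Proof. by move=> /taylorE gb H; rewrite /inner gb; exact: csum_lim. Qed.

Lemma hardy_series f : hardy f -> has_power_series f (taylor f).
Proof. by case=> a [fa _]; rewrite (taylorE fa). Qed.

Lemma hnorm2_cvg f a (s : R) : has_power_series f a ->
  series (fun n => cmod (a n) ^+ 2) @ \oo --> s -> hnorm f ^+ 2 = s.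
Proof.
move=> fa As; rewrite /hnorm (@innerE f f a s%:C) //=.
  rewrite sqr_sqrtr //; apply: (closed_cvg (fun x : R => 0 <= x)) As.
    exact: closed_ge.
  by near=> n; apply: sumr_ge0 => i _; exact: sqr_ge0.
rewrite (taylorE fa); apply: eq_csum (csum_real As) => n.
by rewrite mulcJ_cmod.
Unshelve. all: by end_near. Qed.

Lemma hardy_hnorm2 f : hardy f ->
  csum (fun n => taylor f n * (taylor f n)^*) (hnorm f ^+ 2)%:C.
Proof.
case=> a [fa /cvg_ex[s As]]; rewrite (hnorm2_cvg fa As) (taylorE fa).
by apply: eq_csum (csum_real As) => n; rewrite mulcJ_cmod.
Qed.

Lemma hardyB f g : hardy f -> hardy g -> hardy (fun z => f z - g z).
Proof.
case=> a [fa sa] [b [gb sb]]; exists (fun n => a n - b n); split.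
  move=> z dz; apply: eq_csum (csumB (fa z dz) (gb z dz)) => n.
  by rewrite mulrBl.
pose v n := 2 * cmod (a n) ^+ 2 + 2 * cmod (b n) ^+ 2.
apply: (@series_le_cvg _ _ v) => [n|n|n|].
- exact: sqr_ge0.
- by rewrite addr_ge0 // mulr_ge0 // sqr_ge0.
- exact: cmodB_sqr_le.
rewrite (_ : v = 2 *: (fun n => cmod (a n) ^+ 2) + 2 *: (fun n => cmod (b n) ^+ 2)).
  by apply: is_cvg_seriesD; apply: is_cvg_seriesZ.
by apply/funext.
Qed.

End HardyFunctions.

(** * Reproducing kernels *)

Section Kernels.
Variable R : realType.
Implicit Types (f : R[i] -> R[i]) (l z w : R[i]).

Lemma cmod_lt1_sqr l : disc l -> 0 < 1 - cmod l ^+ 2.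
Proof.
by rewrite /disc /= => l1; rewrite subr_gt0 expr_lt1 // cmod_ge0.
Qed.

Lemma discJM l z : disc l -> disc z -> disc (l^* * z).
Proof.
rewrite /disc /= cmodM cmodJ => l1 z1.
by rewrite (le_lt_trans _ l1) // ler_piMr ?cmod_ge0 // ltW.
Qed.

Lemma kernel_has_power_series l : disc l ->
  has_power_series (kernel_fun l)
    (fun n => (Num.sqrt (1 - cmod l ^+ 2))%:C * l^* ^+ n).
Proof.
move=> dl z dz; rewrite /kernel_fun; set s := (Num.sqrt _)%:C.
have := csumZ s (csum_geometric (discJM dl dz)).
by apply: eq_csum => n; rewrite exprMn mulrA.
Qed.

Lemma kernel_norm_cvg l : disc l ->
  series (fun n => cmod ((Num.sqrt (1 - cmod l ^+ 2))%:C * l^* ^+ n) ^+ 2)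
    @ \oo --> (1 : R).
Proof.
move=> dl; have d0 := cmod_lt1_sqr dl.
have -> : (fun n => cmod ((Num.sqrt (1 - cmod l ^+ 2))%:C * l^* ^+ n) ^+ 2) =
          geometric (1 - cmod l ^+ 2) (cmod l ^+ 2).
  apply/funext => n /=; rewrite cmodM cmodX cmodJ cmod_real exprMn.
  by rewrite real_normK ?num_real // sqr_sqrtr ?(ltW d0) // exprAC.
rewrite -[X in _ --> X](@mulfV _ (1 - cmod l ^+ 2)) ?gt_eqF //.
apply: cvg_geometric_series; rewrite ger0_norm ?sqr_ge0 //.
by rewrite -subr_gt0.
Qed.

Lemma kernel_hardy l : disc l -> hardy (kernel_fun l).
Proof.
move=> dl; eexists; split; first exact: kernel_has_power_series.
exact: cvgP (kernel_norm_cvg dl).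
Qed.

Lemma kernel_hnorm2 l : disc l -> hnorm (kernel_fun l) ^+ 2 = 1.
Proof.
by move=> dl; exact: hnorm2_cvg (kernel_has_power_series dl) (kernel_norm_cvg dl).
Qed.

Lemma kernel_cmod2 l z : disc l ->
  cmod (kernel_fun l z) ^+ 2 = (1 - cmod l ^+ 2) / cmod (1 - l^* * z) ^+ 2.
Proof.
move=> dl; rewrite /kernel_fun cmodM cmodV cmod_real exprMn exprVn.
by rewrite real_normK ?num_real // sqr_sqrtr // ltW // cmod_lt1_sqr.
Qed.

(** The reproducing property of the kernel [1 / (1 - l^* z)], whose Taylor
    coefficients are [l^* ^+ n]. *)
Lemma eval_csum f l : hardy f -> disc l ->
  csum (fun n => taylor f n * (l^* ^+ n)^*) (f l).
Proof.
move=> hf dl; apply: eq_csum (hardy_series hf dl) => n.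
by rewrite -rmorphXn /= conjCK.
Qed.

Lemma inner_kernelB f l w : hardy f -> disc l -> disc w ->
  inner f (fun z => kernel_fun l z - kernel_fun w z) =
  (Num.sqrt (1 - cmod l ^+ 2))%:C * f l - (Num.sqrt (1 - cmod w ^+ 2))%:C * f w.
Proof.
move=> hf dl dw; set s := (Num.sqrt _)%:C; set t := (Num.sqrt _)%:C.
apply: (@innerE _ _ _ (fun n => s * l^* ^+ n - t * w^* ^+ n)).
  move=> z dz.
  apply: eq_csum (csumB (kernel_has_power_series dl dz) (kernel_has_power_series dw dz)) => n.
  by rewrite mulrBl.
apply: eq_csum (csumB (csumZ s (eval_csum hf dl)) (csumZ t (eval_csum hf dw))) => n.
rewrite rmorphB !rmorphM /= !conj_realc; ring.
Qed.

End Kernels.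

(** * The Carleson condition as a bound on sums *)

Section CarlesonSums.
Variable R : realType.
Implicit Types (f : R[i] -> R[i]) (lam : nat -> R[i]).

Lemma cmod_continuous : continuous (fun z : R[i]^o => cmod z : R).
Proof.
move=> z; apply/(@cvgrPdist_lt _ _ _ (nbhs (z : R[i]^o)) (nbhs_filter _)) => e e0.
have e0' : 0 < e%:C :> R[i] by rewrite ltcR.
apply: filterS (@nbhsx_ballx _ _ (z : R[i]^o) _ e0') => w.
rewrite -ball_normE /= normc_cmod ltcR; apply: le_lt_trans.
have := cmod_triangle (z - w) w; have := cmod_triangle (w - z) z.
by rewrite !subrK (cmodC w) ler_norml => H1 H2; apply/andP; split; lra.
Qed.

Lemma continuous_borelC_measurable (D : set (borelC R)) (h : R[i]^o -> R) :
  measurable D -> continuous h -> measurable_fun D (h : borelC R -> R).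
Proof.
move=> mD ch _; apply: (measurability _ (RGenOpens.measurableE R)) => //.
move=> _ [_ [a [b ->] <-]]; apply: measurableI => //.
apply: sub_sigma_algebra.
by move/continuousP : ch; apply; exact: interval_open.
Qed.

Lemma disc_measurable : measurable (@disc R : set (borelC R)).
Proof.
apply: sub_sigma_algebra.
have -> : (@disc R : set R[i]^o) = (fun z : R[i]^o => cmod z : R) @^-1` [set x | x < 1].
  by [].
by apply: open_comp => [z _|]; [exact: cmod_continuous|exact: open_lt].
Qed.

(** A Hardy function is arbitrary outside the disc, so it is measurable only
    there, as the pointwise limit of its Taylor polynomials. *)
Lemma hardy_measurable f : hardy f ->
  measurable_fun (@disc R : set (borelC R)) (fun z : borelC R => (cmod (f z) ^+ 2)%:E).
Proof.
case=> a [fa _]; apply/measurable_EFinP.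
pose p (m : nat) (z : R[i]^o) : R[i]^o := series (fun n => a n * z ^+ n : R[i]^o) m.
pose h (m : nat) (z : R[i]^o) : R := cmod (p m z) ^+ 2.
have p0 : p 0%N = cst 0 by apply/funext => w; rewrite /p /series /= big_geq.
have pS m : p m.+1 = p m + (cst (a m : R[i]^o) \* (fun w => w ^+ m)).
  by apply/funext => w; rewrite /p /series /= big_nat_recr.
have ce m : continuous (fun z : R[i]^o => z ^+ m : R[i]^o).
  elim: m => [|m IH] z.
    have -> : (fun w : R[i]^o => w ^+ 0 : R[i]^o) = cst 1 by [].
    exact: cst_continuous.
  have -> : (fun w : R[i]^o => w ^+ m.+1 : R[i]^o) = id \* (fun w => w ^+ m).
    by apply/funext => w; rewrite exprS.
  by apply: (cvgM _ (IH z)); exact: cvg_id.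
have cp m : continuous (p m).
  elim: m => [|m IH] z; first by rewrite p0; exact: cst_continuous.
  rewrite pS; apply: (cvgD (IH z)).
  by apply: cvgM; [exact: cst_continuous|exact: ce].
have ch m : continuous (h m).
  have hc : continuous (fun z => cmod (p m z)).
    by move=> z; apply: continuous_comp (cp m z) (@cmod_continuous _).
  by move=> z; exact: (cvgM (hc z) (hc z)).
apply: (@measurable_fun_cvg _ (borelC R) R (@disc R) h (fun z => cmod (f z) ^+ 2)) => [m|z dz].
  exact: continuous_borelC_measurable disc_measurable (@ch m).
have hf : (fun m => cmod (p m z)) @ \oo --> cmod (f z).
  exact: (cvg_comp _ _ (fa z dz) (@cmod_continuous _)).
exact: (cvgM hf hf).
Qed.

Lemma integral_atom f l : hardy f -> disc l ->
  (\int[atom l]_(z in (@disc R : set (borelC R))) (cmod (f z) ^+ 2)%:E =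
   ((1 - cmod l ^+ 2) * cmod (f l) ^+ 2)%:E)%E.
Proof.
move=> hf dl; have mf := hardy_measurable hf.
rewrite /atom ge0_integral_mscale //=; last 2 first.
- exact: disc_measurable.
- by move=> z _; rewrite lee_fin sqr_ge0.
rewrite integral_dirac //; last exact: disc_measurable.
by rewrite diracE mem_set // mul1e EFinM ger0_norm // ltW // cmod_lt1_sqr.
Qed.

End CarlesonSums.

Section IndexedSums.
Variable R : realType.

Lemma sub_index_leq n k : `I_n `<=` `I_k -> (n <= k)%N.
Proof. by case: n => // n H; exact: (H n (ltnSn n)). Qed.

(** Truncating to initial segments treats finite and infinite sequences alike;
    the Carleson constant is enlarged to be positive, as the division in
    [bessel_of_gram] requires. *)
Lemma carleson_sum (N : option nat) (lam : nat -> R[i]) :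
  (forall j, index_set N j -> disc (lam j)) -> carleson (mu0 N lam) ->
  exists2 C : R, 0 < C & forall f, hardy f -> forall n, `I_n `<=` index_set N ->
    \sum_(j < n) (1 - cmod (lam j) ^+ 2) * cmod (f (lam j)) ^+ 2
      <= C * hnorm f ^+ 2.
Proof.
move=> dlam [C0 HC]; exists (`|C0| + 1); first by rewrite ltr_pwDr.
move=> f hf n nN.
apply: (@le_trans _ _ (C0 * hnorm f ^+ 2)); last first.
  rewrite ler_wpM2r ?sqr_ge0 //.
  by apply: (le_trans (ler_norm _)); rewrite lerDl.
rewrite -lee_fin; apply: le_trans (HC f hf).
have mf := hardy_measurable hf; have mD := @disc_measurable R.
have f0 (z : borelC R) : disc z -> (0 <= (cmod (f z) ^+ 2)%:E)%E.
  by move=> _; rewrite lee_fin sqr_ge0.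
pose u j := (1 - cmod (lam j) ^+ 2) * cmod (f (lam j)) ^+ 2.
have u0 j : index_set N j -> 0 <= u j.
  by move=> /dlam /cmod_lt1_sqr d0; rewrite mulr_ge0 ?sqr_ge0 // ltW.
rewrite /mu0; case: N dlam HC nN u0 => [k|] dlam HC nN u0.
- rewrite ge0_integral_measure_sum // (eq_bigr (fun j : 'I_k => (u j)%:E)); last first.
    by move=> j _; rewrite integral_atom //; apply: dlam => /=.
  rewrite sumEFin lee_fin (big_ord_widen k u (sub_index_leq nN)).
  by rewrite big_mkcond; apply: ler_sum => j _; case: ifP => // _; exact: u0 (ltn_ord j).
- rewrite ge0_integral_measure_series // (@eq_eseriesr _ _ (fun j => (u j)%:E)); last first.
    by move=> j _; rewrite integral_atom //; apply: dlam.
  apply: le_trans (nneseries_lim_ge n _); last first.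
    by move=> j _ _; rewrite lee_fin; exact: u0.
  by rewrite big_mkord sumEFin.
Qed.

Lemma esum_index_le (N : option nat) (u : nat -> R) (B : R) :
  (forall j, 0 <= u j) ->
  (forall n, `I_n `<=` index_set N -> \sum_(j < n) u j <= B) ->
  (\esum_(j in index_set N) (u j)%:E <= B%:E)%E.
Proof.
move=> u0 H; case: N H => [k|] H.
- rewrite esum_fset; last 2 first.
  + exact: finite_II.
  + by move=> j _; rewrite lee_fin.
  by rewrite -fsbig_ord sumEFin lee_fin; exact: H.
- rewrite -nneseries_esumT; last by move=> j; rewrite lee_fin.
  apply: lime_le.
    by apply: is_cvg_nneseries => j _ _; rewrite lee_fin.
  by near=> n; rewrite big_mkord sumEFin lee_fin; exact: H.
Unshelve. all: by end_near. Qed.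

End IndexedSums.

(** * From Gram matrices to Bessel bounds *)

Section GramBound.
Variable R : realType.

(** Here [a] and [h j] are coefficient sequences, [x j] is the inner product of
    [a] with [h j] and [D] is the Gram matrix of the [h j]. With
    [F = \sum_j w_j x_j h_j], the inner product of [a] and [F] is [S] and the
    squared norm of [F] is at most [M S]; hence
    [0 <= |a - t F|^2 <= A - 2 t S + t^2 M S], and [t = 1 / M] gives
    [S / M <= A]. *)
Lemma bessel_of_gram (a x : nat -> R[i]) (A : R) (n : nat)
    (h D : nat -> nat -> R[i]) (w : nat -> R) (M : R) :
  0 < M ->
  csum (fun k => a k * (a k)^*) A%:C ->
  (forall j, (j < n)%N -> csum (fun k => a k * (h j k)^*) (x j)) ->
  (forall i j, (i < n)%N -> (j < n)%N ->
    csum (fun k => h i k * (h j k)^*) (D i j)) ->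
  let S := \sum_(j < n) w j * cmod (x j) ^+ 2 in
  cmod (\sum_(i < n) \sum_(j < n)
          (w i)%:C * x i * ((w j)%:C * x j)^* * D i j) <= M * S ->
  S <= M * A.
Proof.
move=> M0 HA Hx HD S; set Q := (X in cmod X) => QS.
pose t := M^-1; pose c j := (w j)%:C * x j.
pose g k := \sum_(j < n) c j * h j k.
have Hag : csum (fun k => a k * (g k)^*) S%:C.
  have -> : S%:C = \sum_(j < n) (c j)^* * x j.
    rewrite rmorph_sum; apply: eq_bigr => j _ /=.
    by rewrite rmorphM /= -mulcJ_cmod /c rmorphM /= conj_realc; ring.
  have := csum_sum (fun j jn => csumZ (c j)^* (Hx j jn)).
  apply: eq_csum => k; rewrite rmorph_sum mulr_sumr; apply: eq_bigr => j _.
  by rewrite /c !rmorphM /=; ring.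
have Hgg : csum (fun k => g k * (g k)^*) Q.
  have := csum_sum (fun i im =>
    csum_sum (fun j jn => csumZ (c i * (c j)^*) (HD i j im jn))).
  apply: eq_csum => k; rewrite rmorph_sum mulr_suml; apply: eq_bigr => i _.
  by rewrite mulr_sumr; apply: eq_bigr => j _; rewrite /c !rmorphM /=; ring.
have Hga : csum (fun k => g k * (a k)^*) S%:C.
  rewrite -conj_realc; apply: eq_csum (csumJ Hag) => k.
  by rewrite rmorphM /= conjCK mulrC.
have HL := csumD (csumB (csumB HA (csumZ t%:C Hag)) (csumZ t%:C Hga))
                 (csumZ (t ^+ 2)%:C Hgg).
have := csum_Re_ge0 _ HL.
have E k : a k * (a k)^* - t%:C * (a k * (g k)^*) - t%:C * (g k * (a k)^*)
    + (t ^+ 2)%:C * (g k * (g k)^*)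
  = (a k - t%:C * g k) * (a k - t%:C * g k)^*.
  rewrite rmorphXn rmorphB rmorphM /= conj_realc; ring.
have L0 k : 0 <= complex.Re (a k * (a k)^* - t%:C * (a k * (g k)^*)
    - t%:C * (g k * (a k)^*) + (t ^+ 2)%:C * (g k * (g k)^*)).
  by rewrite E mulcJ_cmod /= sqr_ge0.
move=> /(_ L0).
have ReZ (s : R) (z : R[i]) : complex.Re (s%:C * z) = s * complex.Re z.
  by case: z => ? ? /=; rewrite mul0r subr0.
rewrite !raddfD !raddfN /= !ReZ /=.
have : complex.Re Q <= M * S.
  exact: le_trans (ler_norm _) (le_trans (Re_le_cmod _) QS).
have tM : t * M = 1 by rewrite mulVf // gt_eqF.
have t0 : 0 < t by rewrite invr_gt0.
set q := complex.Re Q; rewrite -/S => qS H.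
have H2 : t ^+ 2 * q <= t * S.
  have : t ^+ 2 * q <= t ^+ 2 * (M * S) by rewrite ler_wpM2l ?sqr_ge0.
  by rewrite expr2 mulrACA tM mul1r.
have H3 : t * S <= A by lra.
have -> : S = M * (t * S) by rewrite mulrA (mulrC M) tM mul1r.
by rewrite ler_wpM2l // ltW.
Qed.

(** By the inequality [2 X_i X_j <= X_i^2 + X_j^2] it suffices
    to bound the row sums of [d_i^2 d_j^2 / y_ij^3] by [2 C d_i]; since
    [d_j <= 2 y_ij], each entry is at most [2 d_i] times the corresponding entry
    of the matrix [d_i d_j / y_ij^2], whose row sums are at most [C]. *)
Lemma schur_cubic (n : nat) (d X : nat -> R) (y : nat -> nat -> R) (C : R) :
  (forall j, (j < n)%N -> 0 <= d j) ->
  (forall i j, (i < n)%N -> (j < n)%N ->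
     [/\ 0 < y i j, y i j = y j i & d i <= 2 * y i j]) ->
  (forall i, (i < n)%N -> \sum_(j < n) d i * d j / y i j ^+ 2 <= C) ->
  \sum_(i < n) \sum_(j < n) X i * X j * (d i ^+ 2 * d j ^+ 2 / y i j ^+ 3)
    <= 2 * C * \sum_(i < n) d i * X i ^+ 2.
Proof.
move=> d0 Hy HC.
pose e i j := d i * d j / y i j ^+ 2.
pose u i j := d i * X i ^+ 2 * e i j.
have He i j : (i < n)%N -> (j < n)%N -> e i j = e j i.
  by move=> im jn; rewrite /e; have [_ -> _] := Hy _ _ im jn; rewrite (mulrC (d i)).
have term i j : (i < n)%N -> (j < n)%N ->
    X i * X j * (d i ^+ 2 * d j ^+ 2 / y i j ^+ 3) <= u i j + u j i.
  move=> im jn; have [y0 yC di] := Hy _ _ im jn.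
  have [_ _] := Hy _ _ jn im; rewrite -yC => dj.
  rewrite /u -(He _ _ im jn); set v := y i j in y0 di dj *.
  have e0 : 0 <= e i j.
    by rewrite /e -/v divr_ge0 ?sqr_ge0 // mulr_ge0 ?d0.
  have -> : X i * X j * (d i ^+ 2 * d j ^+ 2 / v ^+ 3)
    = (X i * X j * (d i * d j / v)) * e i j.
    by rewrite /e -/v; field; rewrite gt_eqF.
  rewrite -mulrDl ler_wpM2r //.
  have P : 0 <= d i * d j / v by rewrite divr_ge0 ?mulr_ge0 ?d0 // ltW.
  have Pi : d i * d j / v <= 2 * d i.
    by rewrite ler_pdivrMr //; have := ler_wpM2l (d0 i im) dj; lra.
  have Pj : d i * d j / v <= 2 * d j.
    by rewrite ler_pdivrMr //; have := ler_wpM2r (d0 j jn) di; lra.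
  move: P Pi Pj; set p := _ / v => P Pi Pj.
  have := ler_wpM2l (sqr_ge0 (X i)) Pi; have := ler_wpM2l (sqr_ge0 (X j)) Pj.
  have := mulr_ge0 P (sqr_ge0 (X i - X j)); nra.
have rowsum i : (i < n)%N -> \sum_(j < n) u i j <= C * (d i * X i ^+ 2).
  move=> im; rewrite -mulr_sumr mulrC ler_wpM2r ?HC //.
  by rewrite mulr_ge0 ?d0 ?sqr_ge0.
apply: (@le_trans _ _ (\sum_(i < n) \sum_(j < n) (u i j + u j i))).
  by apply: ler_sum => i _; apply: ler_sum => j _; exact: term.
under eq_bigr do rewrite big_split /=.
rewrite big_split /= (exchange_big _ _ _ _ _ (fun i j : 'I_n => u j i)) /=.
rewrite -mulrA mulr_natl mulr2n lerD // mulr_sumr; apply: ler_sum => i _; exact: rowsum.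
Qed.

End GramBound.

(** * Geometry of the pseudo-hyperbolic metric *)

Section PseudoHyperbolic.
Variable R : realType.
Implicit Types a b : R[i].

Lemma one_sub_neq0 a b : disc a -> disc b -> 1 - a^* * b != 0.
Proof.
move=> da db; have := discJM da db; rewrite /disc /= subr_eq0 => H.
by apply: contraTneq H => <-; rewrite cmod1 ltxx.
Qed.

Lemma one_sub_gt0 a b : disc a -> disc b -> 0 < cmod (1 - a^* * b).
Proof.
by move=> da db; rewrite lt_def cmod_ge0 cmod_eq0 one_sub_neq0.
Qed.

Lemma one_subC a b : cmod (1 - a^* * b) = cmod (1 - b^* * a).
Proof. by rewrite -[LHS]cmodJ rmorphB rmorph1 rmorphM /= conjCK mulrC. Qed.

Lemma one_sub_ge a b : disc a -> disc b ->
  1 - cmod a ^+ 2 <= 2 * cmod (1 - a^* * b).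
Proof.
rewrite /disc /= => a1 b1.
have := cmod_triangle (1 - a^* * b) (a^* * b).
rewrite subrK cmod1 cmodM cmodJ.
have := cmod_ge0 a; have := cmod_ge0 b; nra.
Qed.

Lemma rhoC a b : rho a b = rho b a.
Proof. by rewrite /rho !cmodM !cmodV cmodC one_subC. Qed.

(** From [1 - a^* b = (1 - |a|^2) + a^* (a - b)] one gets
    [|1 - a^* b| <= (1 - |a|^2) + |a - b|], and [|a - b| < eta |1 - a^* b|]
    is then solved for [|a - b|]. *)
Lemma rho_dist a b (eta r : R) : disc a -> disc b ->
  0 < eta -> eta < r -> r < 1 -> rho a b < eta ->
  cmod (a - b) <= (1 - r)^-1 * eta * (1 - cmod a ^+ 2).
Proof.
move=> da db e0 er r1; rewrite /rho cmodM cmodV.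
have p0 := one_sub_gt0 da db; rewrite ltr_pdivrMr //.
have : cmod (1 - a^* * b) <= (1 - cmod a ^+ 2) + cmod (a - b).
  have -> : 1 - a^* * b = (1 - cmod a ^+ 2)%:C + a^* * (a - b).
    by rewrite rmorphB rmorph1 /= -mulcJ_cmod; ring.
  apply: le_trans (cmod_triangle _ _) _; rewrite cmod_real ger0_norm; last first.
    by rewrite ltW // cmod_lt1_sqr.
  by rewrite lerD // cmodM cmodJ ler_piMl ?cmod_ge0 // ltW.
move: p0 (cmod_ge0 (a - b)); set p := cmod (1 - _); set m := cmod (a - b).
set d := 1 - _ => p0 m0 pd mp.
rewrite -mulrA mulrC ler_pdivlMr; last by rewrite subr_gt0.
have : eta * p <= eta * (d + m) by rewrite ler_pM2l.
have : 0 <= m * (r - eta) by rewrite mulr_ge0 // subr_ge0 ltW.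
lra.
Qed.

(** The displacement of [a] is at most a multiple of [1 - |a'|^2], which is
    itself at most [2 |1 - a'^* b|]. *)
Lemma one_sub_compare a a' b (K : R) : disc a' -> disc b ->
  cmod (a - a') <= K * (1 - cmod a' ^+ 2) -> 0 <= K ->
  cmod (1 - a^* * b) <= (1 + 2 * K) * cmod (1 - a'^* * b).
Proof.
move=> da' db H K0; have := one_sub_ge da' db.
have -> : 1 - a^* * b = (1 - a'^* * b) - (a - a')^* * b.
  by rewrite rmorphB /=; ring.
have := cmod_triangleB (1 - a'^* * b) ((a - a')^* * b).
rewrite cmodM cmodJ; move: db; rewrite /disc /= => b1.
have : cmod (a - a') * cmod b <= cmod (a - a').
  by rewrite ler_piMr ?cmod_ge0 // ltW.
nra.
Qed.

(** The inner product of [K_a - K_a'] and [K_b - K_b'], where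
    [K_a(z) = 1 / (1 - a^* z)]. It is the mixed second difference of
    [1 / (1 - a^* b)]; putting it over a common denominator exhibits the factors
    [conj (a - a')] and [b - b']. *)
Definition gram a a' b b' : R[i] :=
  (a^* - a'^*) * (b - b') * (1 - a^* * b * (a'^* * b')) /
  ((1 - a^* * b) * (1 - a'^* * b) * (1 - a^* * b') * (1 - a'^* * b')).

Lemma gram_csum a a' b b' : disc a -> disc a' -> disc b -> disc b' ->
  csum (fun n => (a^* ^+ n - a'^* ^+ n) * (b^* ^+ n - b'^* ^+ n)^*)
       (gram a a' b b').
Proof.
move=> da da' db db'.
have geo (x y : R[i]) : disc x -> disc y -> csum (fun n => (x^* * y) ^+ n) (1 - x^* * y)^-1.
  by move=> dx dy; exact: csum_geometric (discJM dx dy).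
have -> : gram a a' b b' = (1 - a^* * b)^-1 - (1 - a'^* * b)^-1
    - ((1 - a^* * b')^-1 - (1 - a'^* * b')^-1).
  by rewrite /gram; field; rewrite !one_sub_neq0.
have := csumB (csumB (geo _ _ da db) (geo _ _ da' db))
              (csumB (geo _ _ da db') (geo _ _ da' db')).
apply: eq_csum => n; rewrite rmorphB -!rmorphXn /= !rmorphXn /= !conjCK !exprMn.
by ring.
Qed.

(** The third factor of the numerator of [gram] equals
    [(1 - a^* b) + a^* b (1 - a'^* b')], so it cancels one of the four factors
    of the denominator; the other three are comparable to [|1 - a^* b|]. *)
Lemma gram_bound a a' b b' (k L eta : R) :
  disc a -> disc a' -> disc b -> disc b' -> 0 <= k -> 0 <= eta -> 0 <= L ->
  cmod (a - a') <= k * eta * (1 - cmod a ^+ 2) ->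
  cmod (b - b') <= k * eta * (1 - cmod b ^+ 2) ->
  cmod (1 - a^* * b) <= L * cmod (1 - a'^* * b) ->
  cmod (1 - a^* * b) <= L * cmod (1 - a^* * b') ->
  cmod (1 - a^* * b) <= L ^+ 2 * cmod (1 - a'^* * b') ->
  cmod (gram a a' b b') <= (k * eta) ^+ 2 * L ^+ 2 * (1 + L ^+ 2) *
    ((1 - cmod a ^+ 2) * (1 - cmod b ^+ 2) / cmod (1 - a^* * b) ^+ 3).
Proof.
move=> da da' db db' k0 e0 L0 Ha Hb.
have da0 := cmod_lt1_sqr da; have db0 := cmod_lt1_sqr db.
rewrite /gram !cmodM cmodV !cmodM -rmorphB /= cmodJ.
have := cmod_triangle (1 - a^* * b) (a^* * b * (1 - a'^* * b')).
have -> : 1 - a^* * b + a^* * b * (1 - a'^* * b') = 1 - a^* * b * (a'^* * b').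
  by ring.
rewrite [cmod (a^* * b * (1 - _))]cmodM.
have := ltW (discJM da db).
have := one_sub_gt0 da db; have := one_sub_gt0 da' db.
have := one_sub_gt0 da db'; have := one_sub_gt0 da' db'.
set x := cmod (1 - a^* * b); set p := cmod (1 - a'^* * b).
set q := cmod (1 - a^* * b'); set y := cmod (1 - a'^* * b').
set v := cmod (1 - _); set c := cmod (a^* * b).
set da_ := 1 - cmod a ^+ 2 in Ha da0 *; set db_ := 1 - cmod b ^+ 2 in Hb db0 *.
move=> y0 q0 p0 x0 c1 vb xp xq xy.
have vxy : v <= x + y.
  by apply: le_trans vb _; rewrite lerD2l ler_piMl // ltW.
have inv (z M : R) : 0 < z -> 0 <= M -> x <= M * z -> z^-1 <= M / x.
  by move=> z0 M0 H; rewrite -div1r ler_pdivrMr // mulrAC ler_pdivlMr // mul1r.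
have Hp := inv _ _ p0 L0 xp; have Hq := inv _ _ q0 L0 xq.
have Hy := inv _ _ y0 (exprn_ge0 2 L0) xy.
have -> : cmod (a - a') * cmod (b - b') * v / (x * p * q * y) =
   (cmod (a - a') * cmod (b - b')) * (v / (x * y)) * (p^-1 * q^-1).
  by field; rewrite !gt_eqF.
have -> : (k * eta) ^+ 2 * L ^+ 2 * (1 + L ^+ 2) * (da_ * db_ / x ^+ 3) =
  ((k * eta * da_) * (k * eta * db_)) * ((1 + L ^+ 2) / x) * ((L / x) * (L / x)).
  by field; rewrite gt_eqF.
have vxy' : v / (x * y) <= (1 + L ^+ 2) / x.
  apply: (@le_trans _ _ ((x + y) / (x * y))).
    by rewrite ler_wpM2r // invr_ge0 mulr_ge0 // ltW.
  have -> : (x + y) / (x * y) = x^-1 + y^-1 by field; rewrite !gt_eqF.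
  by rewrite mulrDl mul1r lerD2l.
have ip : 0 <= p^-1 by rewrite invr_ge0 ltW.
have iq : 0 <= q^-1 by rewrite invr_ge0 ltW.
have v0 : 0 <= v / (x * y) by rewrite divr_ge0 ?cmod_ge0 // mulr_ge0 // ltW.
have ab : cmod (a - a') * cmod (b - b') <= k * eta * da_ * (k * eta * db_).
  by rewrite ler_pM ?cmod_ge0.
have pq : p^-1 * q^-1 <= L / x * (L / x) by rewrite ler_pM.
have ab0 : 0 <= cmod (a - a') * cmod (b - b') by rewrite mulr_ge0 ?cmod_ge0.
apply: ler_pM => //; [exact: mulr_ge0|exact: mulr_ge0|exact: ler_pM].
Qed.

End PseudoHyperbolic.

(** * Moving the points of a Carleson sequence *)

Section KernelDifferences.
Variable R : realType.
Implicit Types a b : R[i].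

Lemma one_sub_compare_pair a a' b b' (k : R) :
  disc a -> disc a' -> disc b -> disc b' -> 0 <= k ->
  cmod (a - a') <= k * (1 - cmod a' ^+ 2) ->
  cmod (b - b') <= k * (1 - cmod b' ^+ 2) ->
  [/\ cmod (1 - a^* * b) <= (1 + 2 * k) * cmod (1 - a'^* * b),
      cmod (1 - a^* * b) <= (1 + 2 * k) * cmod (1 - a^* * b') &
      cmod (1 - a^* * b) <= (1 + 2 * k) ^+ 2 * cmod (1 - a'^* * b')].
Proof.
move=> da da' db db' k0 Ha Hb.
have H1 := one_sub_compare da' db Ha k0.
have flip c : disc c ->
    cmod (1 - c^* * b) <= (1 + 2 * k) * cmod (1 - c^* * b').
  by move=> dc; rewrite (one_subC c b) (one_subC c b'); exact: one_sub_compare.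
split; [exact: H1|exact: flip|].
apply: le_trans H1 _; rewrite expr2 -mulrA ler_wpM2l ?flip //.
by rewrite addr_ge0 // mulr_ge0.
Qed.

(** The numerator of
    [s - s' = (|a'|^2 - |a|^2) / (s + s')] is at most [2 |a - a'|], and the
    denominator is at least [s]. *)
Lemma normalization_dist a a' (c : R) : disc a -> disc a' ->
  cmod (a - a') <= c * (1 - cmod a ^+ 2) ->
  `|Num.sqrt (1 - cmod a ^+ 2) - Num.sqrt (1 - cmod a' ^+ 2)|
    <= 2 * c * Num.sqrt (1 - cmod a ^+ 2).
Proof.
move=> da da' H; have d0 := cmod_lt1_sqr da; have d0' := cmod_lt1_sqr da'.
set s := Num.sqrt (1 - cmod a ^+ 2); set s' := Num.sqrt _.
have s0 : 0 < s by rewrite sqrtr_gt0.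
have s0' : 0 <= s' by exact: sqrtr_ge0.
have sE : s ^+ 2 = 1 - cmod a ^+ 2 by rewrite sqr_sqrtr // ltW.
have sE' : s' ^+ 2 = 1 - cmod a' ^+ 2 by rewrite sqr_sqrtr // ltW.
rewrite -(ler_pM2r s0).
apply: (@le_trans _ _ (`|s - s'| * (s + s'))).
  by rewrite ler_wpM2l // lerDl.
have -> : `|s - s'| * (s + s') = `|s ^+ 2 - s' ^+ 2|.
  by rewrite subr_sqr normrM (ger0_norm (addr_ge0 (ltW s0) s0')).
have -> : 2 * c * s * s = 2 * c * s ^+ 2 by ring.
rewrite sE sE'.
have T1 : cmod a - cmod a' <= cmod (a - a').
  by have := cmod_triangle (a - a') a'; rewrite subrK; lra.
have T2 : cmod a' - cmod a <= cmod (a - a').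
  by rewrite cmodC; have := cmod_triangle (a' - a) a; rewrite subrK; lra.
move: da da'; rewrite /disc /= => a1 a1'.
have := cmod_ge0 a; have := cmod_ge0 a'.
by rewrite ler_norml => ? ?; apply/andP; split; nra.
Qed.

(** This is the Carleson inequality tested on the unit vector
    [kernel_fun (lam i)]. *)
Lemma kernel_row_sum (C : R) (n : nat) (lam : nat -> R[i]) :
  (forall j, (j < n)%N -> disc (lam j)) ->
  (forall f, hardy f ->
    \sum_(j < n) (1 - cmod (lam j) ^+ 2) * cmod (f (lam j)) ^+ 2
      <= C * hnorm f ^+ 2) ->
  forall i, (i < n)%N ->
  \sum_(j < n) (1 - cmod (lam i) ^+ 2) * (1 - cmod (lam j) ^+ 2) /
     cmod (1 - (lam i)^* * lam j) ^+ 2 <= C.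
Proof.
move=> dlam HC i im; have di := dlam i im.
have := HC _ (kernel_hardy di); rewrite kernel_hnorm2 // mulr1.
by apply: le_trans; apply: ler_sum => j _; rewrite kernel_cmod2 // mulrCA mulrA.
Qed.

(** The unnormalized part of the theorem: [bessel_of_gram] for the kernel
    differences, weighted by [1 - |lam j|^2]. These weights turn the bound of
    [gram_bound] into the matrix of [schur_cubic]. *)
Lemma evaluation_difference (C k eta : R) (n : nat) (lam lam' : nat -> R[i])
    (f : R[i] -> R[i]) :
  0 < C -> 0 < k -> 0 < eta -> eta <= 1 ->
  (forall j, (j < n)%N -> disc (lam j)) ->
  (forall j, (j < n)%N -> disc (lam' j)) ->
  (forall j, (j < n)%N ->
    cmod (lam j - lam' j) <= k * eta * (1 - cmod (lam j) ^+ 2)) ->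
  (forall j, (j < n)%N ->
    cmod (lam j - lam' j) <= k * eta * (1 - cmod (lam' j) ^+ 2)) ->
  (forall i, (i < n)%N ->
    \sum_(j < n) (1 - cmod (lam i) ^+ 2) * (1 - cmod (lam j) ^+ 2) /
      cmod (1 - (lam i)^* * lam j) ^+ 2 <= C) ->
  hardy f ->
  \sum_(j < n) (1 - cmod (lam j) ^+ 2) * cmod (f (lam j) - f (lam' j)) ^+ 2
    <= 2 * C * ((k * eta) ^+ 2 * (1 + 2 * k) ^+ 2 * (1 + (1 + 2 * k) ^+ 2))
         * hnorm f ^+ 2.
Proof.
move=> C0 k0 e0 e1 dl dl' H H' HC hf; set L := 1 + 2 * k.
set T := _ ^+ 2 * _ * _; set M := 2 * C * T.
have L0 : 0 < L by rewrite /L; lra.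
have T0 : 0 < T.
  apply: mulr_gt0; first by rewrite mulr_gt0 ?exprn_gt0 // mulr_gt0.
  by rewrite ltr_wpDr ?sqr_ge0.
have M0 : 0 < M by rewrite mulr_gt0 // mulr_gt0.
pose d j : R := 1 - cmod (lam j) ^+ 2.
pose x j := f (lam j) - f (lam' j).
pose h j m := (lam j)^* ^+ m - (lam' j)^* ^+ m.
pose D i j := gram (lam i) (lam' i) (lam j) (lam' j).
have d0 j : (j < n)%N -> 0 < d j by move=> jn; apply: cmod_lt1_sqr; exact: dl.
have Hx j : (j < n)%N -> csum (fun m => taylor f m * (h j m)^*) (x j).
  move=> jn; have := csumB (eval_csum hf (dl j jn)) (eval_csum hf (dl' j jn)).
  by apply: eq_csum => m; rewrite -mulrBr -rmorphB.
have HD i j : (i < n)%N -> (j < n)%N ->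
    csum (fun m => h i m * (h j m)^*) (D i j).
  by move=> im jn; apply: gram_csum; [exact: dl|exact: dl'|exact: dl|exact: dl'].
apply: (bessel_of_gram (w := d) M0 (hardy_hnorm2 hf) Hx HD).
pose y i j := cmod (1 - (lam i)^* * lam j).
have Hy i j : (i < n)%N -> (j < n)%N ->
    [/\ 0 < y i j, y i j = y j i & d i <= 2 * y i j].
  move=> im jn; split; [|exact: one_subC|].
    by apply: one_sub_gt0; exact: dl.
  by apply: one_sub_ge; exact: dl.
have := schur_cubic (fun j => cmod (x j)) (fun j jn => ltW (d0 j jn)) Hy HC.
rewrite -(ler_pM2l T0).
set S := \sum_(j < n) d j * _ => HS.
have -> : M * S = T * (2 * C * S) by rewrite /M; ring.
apply: le_trans HS; rewrite mulr_sumr.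
apply: le_trans (cmod_sum _ _ _) _; apply: ler_sum => i _.
rewrite mulr_sumr; apply: le_trans (cmod_sum _ _ _) _; apply: ler_sum => j _.
have [im jn] := (ltn_ord i, ltn_ord j).
have close m : (m < n)%N -> cmod (lam m - lam' m) <= k * (1 - cmod (lam' m) ^+ 2).
  move=> mn; apply: le_trans (H' m mn) _.
  rewrite ler_wpM2r ?ler_piMr ?(ltW k0) //.
  by apply/ltW/cmod_lt1_sqr; exact: dl'.
have [c1 c2 c3] := one_sub_compare_pair (dl i im) (dl' i im) (dl j jn) (dl' j jn)
  (ltW k0) (close i im) (close j jn).
have := gram_bound (dl i im) (dl' i im) (dl j jn) (dl' j jn)
  (ltW k0) (ltW e0) (ltW L0) (H i im) (H j jn) c1 c2 c3.
rewrite -/T -/(D i j) -/(d i) -/(d j) -/(y i j).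
move: (D i j) => G HG.
rewrite !cmodM cmodJ !cmodM !cmod_real.
rewrite (ger0_norm (ltW (d0 i im))) (ger0_norm (ltW (d0 j jn))).
set u := d i * cmod (x i) * (d j * cmod (x j)).
have u0 : 0 <= u by rewrite !mulr_ge0 ?cmod_ge0 // ltW // d0.
apply: (le_trans (ler_wpM2l u0 HG)).
by rewrite le_eqVlt; apply/orP; left; apply/eqP; rewrite /u; ring.
Qed.

End KernelDifferences.

Unset Implicit Arguments.
Set Strict Implicit.

Theorem theorem2p7 (R : realType) (N : option nat) (lam : nat -> R[i])
    (lam_disc : forall j, index_set N j -> disc (lam j))
    (lam_carleson : carleson (mu0 N lam))
    (r : R) (r_gt0 : 0 < r) (r_lt1 : r < 1) :
  exists C : R, 0 < C /\
    forall (eta : R) (lam' : nat -> R[i]),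
      0 < eta -> eta < r ->
      (forall j, index_set N j -> Delta (lam j) eta (lam' j)) ->
      let g := fun j z => kernel_fun (lam j) z - kernel_fun (lam' j) z in
      [/\ bessel N g,
          bessel_const N g <= C * eta
        & forall f, hardy f ->
            (\esum_(j in index_set N) (cmod (inner f (g j)) ^+ 2)%:E
               <= (C ^+ 2 * eta ^+ 2 * hnorm f ^+ 2)%:E)%E].
Proof.
have [C0 C0_gt0 HC0] := carleson_sum lam_disc lam_carleson.
pose k := (1 - r)^-1; pose L := 1 + 2 * k.
have k0 : 0 < k by rewrite invr_gt0 subr_gt0.
have L0 : 0 < L by rewrite /L; lra.
(* 2 (2 k eta)^2 C0 from the change of normalization and
   2 L^2 (2 C0) (k eta)^2 L^2 (1 + L^2) from the change of evaluation point,
   where L s bounds the new normalization s'. *)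
pose K := 8 * k ^+ 2 * C0 + 4 * L ^+ 2 * C0 * (k ^+ 2 * L ^+ 2 * (1 + L ^+ 2)).
have K0 : 0 < K.
  have ? : 0 < k ^+ 2 by exact: exprn_gt0.
  have ? : 0 < L ^+ 2 by exact: exprn_gt0.
  by rewrite addr_gt0 ?mulr_gt0 // addr_gt0.
exists (Num.sqrt K); split; first by rewrite sqrtr_gt0.
move=> eta lam' e0 er close g; rewrite sqr_sqrtr ?(ltW K0) //.
have lam'_disc j : index_set N j -> disc (lam' j) by move=> /close [].
have dist j : index_set N j ->
    cmod (lam j - lam' j) <= k * eta * (1 - cmod (lam j) ^+ 2).
  move=> Nj; have [dj' rj] := close j Nj; exact: rho_dist (lam_disc j Nj) dj' e0 er r_lt1 rj.
have dist' j : index_set N j ->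
    cmod (lam j - lam' j) <= k * eta * (1 - cmod (lam' j) ^+ 2).
  move=> Nj; have [dj' rj] := close j Nj; rewrite cmodC; rewrite rhoC in rj.
  exact: rho_dist dj' (lam_disc j Nj) e0 er r_lt1 rj.
have e1 : eta <= 1 by rewrite ltW // (lt_trans er).
have bound f : hardy f ->
    (\esum_(j in index_set N) (cmod (inner f (g j)) ^+ 2)%:E
       <= (K * eta ^+ 2 * hnorm f ^+ 2)%:E)%E.
  move=> hf; apply: esum_index_le => [j|n nN]; first exact: sqr_ge0.
  have dl j (jn : (j < n)%N) := lam_disc j (nN j jn).
  have dl' j (jn : (j < n)%N) := lam'_disc j (nN j jn).
  have := evaluation_difference C0_gt0 k0 e0 e1 dl dl'
    (fun j jn => dist j (nN j jn)) (fun j jn => dist' j (nN j jn))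
    (kernel_row_sum dl (fun f hf => HC0 f hf n nN)) hf.
  have := HC0 f hf n nN; rewrite -/L.
  set F := hnorm f ^+ 2; set S1 := \sum_(j < n) _; set S2 := \sum_(j < n) _.
  move=> H1 H2.
  apply: (@le_trans _ _ (2 * (2 * k * eta) ^+ 2 * S1 + 2 * L ^+ 2 * S2)).
    rewrite !mulr_sumr -big_split /=; apply: ler_sum => j _.
    have jn := ltn_ord j; have dj := dl j jn; have dj' := dl' j jn.
    rewrite inner_kernelB //.
    have := normalization_dist dj dj' (dist j (nN j jn)).
    have sE := sqr_sqrtr (ltW (cmod_lt1_sqr dj)).
    have := sqrtr_ge0 (1 - cmod (lam' j) ^+ 2).
    have := sqrtr_ge0 (1 - cmod (lam j) ^+ 2).
    set s := Num.sqrt (1 - cmod (lam j) ^+ 2) in sE *; set s' := Num.sqrt _.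
    rewrite -sE => s0 s0' ss'.
    have -> : s%:C * f (lam j) - s'%:C * f (lam' j) =
        (s - s')%:C * f (lam j) - (- s')%:C * (f (lam j) - f (lam' j)).
      by rewrite rmorphB rmorphN /=; ring.
    apply: le_trans (cmodB_sqr_le _ _) _.
    rewrite !cmodM !cmod_real normrN (ger0_norm s0') !exprMn.
    have ss2 : `|s - s'| ^+ 2 <= (2 * (k * eta) * s) ^+ 2.
      by rewrite lerXn2r ?nnegrE // !mulr_ge0 // ltW.
    have s'L : s' ^+ 2 <= (L * s) ^+ 2.
      rewrite lerXn2r ?nnegrE ?mulr_ge0 ?(ltW L0) //.
      have : k * eta * s <= k * s by rewrite ler_wpM2r // ler_piMr // ltW.
      by move: ss'; rewrite distrC => /(le_trans (ler_norm _)); rewrite /L; lra.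
    rewrite lerD //.
      have := ler_wpM2r (sqr_ge0 (cmod (f (lam j)))) ss2.
      by rewrite !exprMn; lra.
    have := ler_wpM2r (sqr_ge0 (cmod (f (lam j) - f (lam' j)))) s'L.
    by rewrite !exprMn; lra.
  have q1 : 0 <= 2 * (2 * k * eta) ^+ 2 by rewrite pmulr_rge0 ?sqr_ge0.
  have q2 : 0 <= 2 * L ^+ 2 by rewrite pmulr_rge0 ?sqr_ge0.
  apply: (le_trans (lerD (ler_wpM2l q1 H1) (ler_wpM2l q2 H2))).
  by rewrite le_eqVlt; apply/orP; left; apply/eqP; rewrite /K; ring.
have BB : bessel_bound N g (Num.sqrt K * eta).
  split=> [|f hf]; first by rewrite mulr_ge0 ?sqrtr_ge0 // ltW.
  by rewrite exprMn sqr_sqrtr ?(ltW K0) //; exact: bound.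
split=> //.
- split; last by exists (Num.sqrt K * eta).
  by move=> j Nj; apply: hardyB; apply: kernel_hardy; [exact: lam_disc|exact: lam'_disc].
- rewrite /bessel_const -[leRHS]ger0_norm; last by case: BB.
  rewrite -sqrtr_sqr ler_wsqrtr // /bessel_const2; apply: ge_inf.
    by exists 0 => _ [B _ <-]; exact: sqr_ge0.
  by exists (Num.sqrt K * eta).
Qed.
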